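(* For every integer $n\geq4$, the wheel $W_n$ is of class $1^\pm$.
   Context: The wheel $W_n$ ($n\geq4$) is the graph on $n$ vertices consisting of a cycle $C_{n-1}$, a further vertex $v$, and edges joining $v$ to every vertex of the cycle. A signed graph is a pair $(G,\sigma)$ with $G$ a finite simple graph and $\sigma\colon E(G)\to\{\pm1\}$ a signature. An incidence is a pair $v\colon e$ with $v$ an endpoint of edge $e$; $I(G)$ is the set of incidences. For a positive integer $n$ let $M_n=\{0,\pm1,\dots,\pm k\}$ if $n=2k+1$ and $M_n=\{\pm1,\dots,\pm k\}$ if $n=2k$. An $n$-edge-coloring of $(G,\sigma)$ is a map $f\colon I(G)\to M_n$ with $f(u\colon uv)=-\sigma(uv)f(v\colon uv)$ for every edge $uv$, and $f(u\colon e_1)\neq f(u\colon e_2)$ whenever $e_1\neq e_2$ are both incident to $u$. The chromatic index $\chi'(G,\sigma)$ is the least positive integer $n$ for which an $n$-edge-coloring exists. A graph $G$ is of class $1^\pm$ if $\chi'(G,\sigma)=\Delta(G)$ for every signature $\sigma$ of $G$, where $\Delta(G)$ is the maximum degree. *)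

(* Defs.v *)
From mathcomp Require Import all_boot all_order all_algebra.

Set Implicit Arguments.
Unset Strict Implicit.
Unset Printing Implicit Defensive.

Import Order.TTheory GRing.Theory Num.Theory.

Record simple_graph (T : finType) := SimpleGraph {
  adj :> rel T;
  adj_sym : symmetric adj;
  adj_irr : irreflexive adj
}.

Section SignedGraphs.
Variables (T : finType) (G : simple_graph T).

Definition edges : {set {set T}} :=
  [set [set p.1; p.2] | p : T * T & adj G p.1 p.2].

Definition incidence (v : T) (e : {set T}) : bool := (e \in edges) && (v \in e).

Definition degree (v : T) : nat := #|[set u | adj G v u]|.

Definition max_degree : nat := \max_(v : T) degree v.

(* Signatures and colorings are total functions of which only the values on
   edges, respectively on incidences, are constrained and used. *)
Definition signature (sigma : {set T} -> int) : Prop :=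
  forall e, e \in edges -> sigma e = 1%R \/ sigma e = (-1)%R.

Definition palette (n : nat) : pred int :=
  [pred c | (`|c| <= n./2)%N && (odd n || (c != 0%R))].

Definition edge_coloring (sigma : {set T} -> int) (n : nat)
    (f : T -> {set T} -> int) : Prop :=
  [/\ forall v e, incidence v e -> f v e \in palette n,
      forall u v, adj G u v ->
        f u [set u; v] = (- sigma [set u; v] * f v [set u; v])%R
    & forall u e1 e2, incidence u e1 -> incidence u e2 -> e1 != e2 ->
        f u e1 != f u e2].

Definition edge_colorable (sigma : {set T} -> int) (n : nat) : Prop :=
  exists f, edge_coloring sigma n f.

Definition is_chromatic_index (sigma : {set T} -> int) (n : nat) : Prop :=
  [/\ 0 < n, edge_colorable sigma n
    & forall m, 0 < m -> edge_colorable sigma m -> n <= m].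

Definition class1pm : Prop :=
  forall sigma, signature sigma -> is_chromatic_index sigma max_degree.

End SignedGraphs.

Section Wheel.
Variable n : nat.

(* [None] is the hub and [Some i] are the rim vertices, so that there are n
   vertices for n > 0. The condition [i != j] only matters for n = 2. *)
Definition wheel_rel : rel (option 'I_n.-1) := fun x y =>
  match x, y with
  | None, None => false
  | Some i, Some j => (i != j) && ((j == ordS i) || (i == ordS j))
  | _, _ => true
  end.

Lemma wheel_rel_sym : symmetric wheel_rel.
Proof. by move=> [i|] [j|] //=; rewrite eq_sym orbC. Qed.

Lemma wheel_rel_irr : irreflexive wheel_rel.
Proof. by move=> [i|] //=; rewrite eqxx. Qed.

Definition wheel : simple_graph (option 'I_n.-1) :=
  SimpleGraph wheel_rel_sym wheel_rel_irr.

End Wheel.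

(* Main.v *)
Require Import Defs.
From mathcomp Require Import all_boot all_order all_algebra zify ring.

Set Implicit Arguments.
Unset Strict Implicit.
Unset Printing Implicit Defensive.

Import Order.TTheory GRing.Theory Num.Theory.

(** Write m = n - 1. The hub forces at least m colors. For the converse, switch
    the rim vertices until both incidences of every spoke have the same color.
    It remains to choose spoke colors [a i], distinct in the palette, and rim
    colors [b i] for the edge from i to i + 1 (seen from i), such that
    [a i], [b i] and [s (i - 1) * b (i - 1)] are distinct at every rim vertex i,
    where the signs [s] are arbitrary. For m >= 4 there is a choice which works
    for all signs at once: if cyclically consecutive spokes have distinct
    absolute values, then [b i := - a i] works apart from the spoke of color 0,
    near which three rim colors are adjusted. For m = 3 two of the three rim
    signs agree, and 0 goes to the spoke between the corresponding edges. *)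

(** * Color choices around the rim, and the size of the palette *)

Definition is_sign (s : int) : Prop := s = 1%R \/ s = (-1)%R.

Record rim_scheme (m : nat) (s a b : nat -> int) : Prop := RimScheme {
  spoke_palette : forall i, i < m -> a i \in palette m;
  rim_palette : forall i, i < m -> b i \in palette m;
  spoke_inj : forall i j, i < m -> j < m -> a i = a j -> i = j;
  rim_neq_spoke : forall i, i < m -> b i <> a i;
  rim_neq_next_spoke : forall i, i < m -> (s i * b i)%R <> a (i.+1 %% m);
  rim_neq_next_rim : forall i, i < m -> (s i * b i)%R <> b (i.+1 %% m)
}.

Lemma modnS_small m i : i < m -> i.+1 %% m = if i.+1 == m then 0 else i.+1.
Proof.
move=> lt_im; case: eqP => [->|ne]; first by rewrite modnn.
by rewrite modn_small; lia.
Qed.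

(** Reduces the conditions for all signs at once to a comparison of absolute values. *)
Lemma sign_neq (s c d : int) : is_sign s -> absz c <> absz d -> (s * c)%R <> d.
Proof. by case=> ->; lia. Qed.

Lemma rim_scheme3 (s : nat -> int) :
  (forall i, is_sign (s i)) -> exists a b, rim_scheme 3 s a b.
Proof.
move=> sP.
have [e01|[e12|e20]] : s 0 = s 1 \/ s 1 = s 2 \/ s 2 = s 0.
- by case: (sP 0) (sP 1) (sP 2) => -> [->|->] [->|->]; tauto.
(* Vertex 1 sees its two rim edges as 1 and -1. At their far ends each shows the negative of the
   spoke there, and the opposite edge gets 0, which no sign changes. The other two cases are
   rotations of this one. *)
- exists (nth 0%R [:: -1; 0; 1]%R), (nth 0%R [:: 1; - s 1; 0]%R).
  by case: (sP 1) => E1; move: (e01); rewrite E1 => E0;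
    split=> [[|[|[|i]]]|[|[|[|i]]]|[|[|[|i]]] [|[|[|j]]]|[|[|[|i]]]|
             [|[|[|i]]]|[|[|[|i]]]] //=; rewrite ?E0 ?E1 ?mulr0.
- exists (nth 0%R [:: 1; -1; 0]%R), (nth 0%R [:: 0; 1; - s 2]%R).
  by case: (sP 2) => E1; move: (e12); rewrite E1 => E0;
    split=> [[|[|[|i]]]|[|[|[|i]]]|[|[|[|i]]] [|[|[|j]]]|[|[|[|i]]]|
             [|[|[|i]]]|[|[|[|i]]]] //=; rewrite ?E0 ?E1 ?mulr0.
- exists (nth 0%R [:: 0; 1; -1]%R), (nth 0%R [:: - s 0; 0; 1]%R).
  by case: (sP 0) => E1; move: (e20); rewrite E1 => E0;
    split=> [[|[|[|i]]]|[|[|[|i]]]|[|[|[|i]]] [|[|[|j]]]|[|[|[|i]]]|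
             [|[|[|i]]]|[|[|[|i]]]] //=; rewrite ?E0 ?E1 ?mulr0.
Qed.

Lemma rim_scheme_even k (s : nat -> int) :
  2 <= k -> (forall i, is_sign (s i)) -> exists a b, rim_scheme k.*2 s a b.
Proof.
move=> k2 sP.
(* The absolute values run twice through 1, ..., k, so cyclic neighbors differ in absolute value
   because k >= 2. *)
pose a i : int := if i < k then Posz i.+1 else (- Posz (i - k).+1)%R.
exists a, (fun i => - a i)%R; rewrite /a.
split=> [i|i|i j||i|i].
- by rewrite inE /= doubleK odd_double /=; case: ifP; lia.
- by rewrite inE /= doubleK odd_double /=; case: ifP; lia.
- by case: ifP; case: ifP; lia.
- by move=> i; case: ifP; lia.
- move=> lt; apply: sign_neq => //; rewrite modnS_small //.
  by case: ifP; case: ifP; case: ifP; lia.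
- move=> lt; apply: sign_neq => //; rewrite modnS_small //.
  by case: ifP; case: ifP; case: ifP; lia.
Qed.

Lemma rim_scheme_odd k (s : nat -> int) :
  2 <= k -> (forall i, is_sign (s i)) -> exists a b, rim_scheme k.*2.+1 s a b.
Proof.
move=> k2 sP.
pose a i : int := if i <= k then Posz i else (- Posz (i - k))%R.
(* [- a 0] would repeat the color 0 at vertex 0, so edge 0 gets 2. Edge 2k must then avoid absolute
   value 2, which [- a] takes there when k = 2; it gets 1. Edge 2k - 1 must in turn avoid absolute
   values k and 1; it gets 0. *)
pose b i : int := if i == 0 then Posz 2 else if i == k.*2 then Posz 1
  else if i == k.*2.-1 then Posz 0 else (- a i)%R.
exists a, b; rewrite /b /a.
split=> [i|i|i j||i|i].
- by rewrite inE /= odd_double uphalf_double /=; case: ifP; lia.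
- by rewrite inE /= odd_double uphalf_double /=; do 4?case: ifP; lia.
- by case: ifP; case: ifP; lia.
- by move=> i; do 4?case: ifP; lia.
- move=> lt; apply: sign_neq => //; rewrite modnS_small //.
  by case: (i.+1 == _) / eqP => ? /=; do 5?case: ifP; lia.
- move=> lt; apply: sign_neq => //; rewrite modnS_small //.
  by case: (i.+1 == _) / eqP => ? /=; do 8?case: ifP; lia.
Qed.

Lemma rim_scheme_exists m (s : nat -> int) :
  3 <= m -> (forall i, is_sign (s i)) -> exists a b, rim_scheme m s a b.
Proof.
move=> m3 sP; have [->|ne3] := eqVneq m 3; first exact: rim_scheme3.
rewrite -(odd_double_half m); case: (odd m) (odd_double_half m) => /= E.
  by apply: rim_scheme_odd => //; lia.
by apply: rim_scheme_even => //; lia.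
Qed.

(** Numbers the palette from 0 to m - 1: shift by [m./2], and for even m close the gap left by the
    missing color 0. *)
Definition palette_code (m : nat) (c : int) : nat :=
  if (odd m || (c < 0)%R) then absz (c + Posz m./2)%R else (absz (c + Posz m./2)%R).-1.

Lemma palette_code_lt m c : c \in palette m -> palette_code m c < m.
Proof.
have := odd_double_half m; rewrite inE /palette_code /=.
by case: (odd m) => /=; [|case: ifP]; lia.
Qed.

Lemma palette_code_inj m : {in palette m &, injective (palette_code m)}.
Proof.
move=> c d; rewrite !inE /palette_code /=.
by case: (odd m) => /=; [|case: ifP; case: ifP]; lia.
Qed.

(** * Degree bound and coloring criterion for arbitrary graphs *)

Section Graph.
Variables (T : finType) (G : simple_graph T).

Lemma incidenceP v e :
  reflect (exists2 u, adj G v u & e = [set v; u]) (incidence G v e).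
Proof.
apply: (iffP andP) => [[/imsetP[[x y]]]|[u vu ->]].
  rewrite inE /= => xy ->; rewrite !inE => /orP[]/eqP->; first by exists y.
  by exists x; rewrite 1?adj_sym // setUC.
by split; [apply/imsetP; exists (v, u); rewrite ?inE | rewrite !inE eqxx].
Qed.

Lemma set2_inj (v u w : T) : [set v; u] = [set v; w] -> u = w.
Proof.
move=> /setP E; move: (E u) (E w); rewrite !inE !eqxx !orbT.
by case: (u =P v) (w =P v) => [->|_] [->|_] //= /esym/eqP.
Qed.

Lemma degree_le_palette sigma m v :
  edge_colorable G sigma m -> degree G v <= m.
Proof.
case=> f [fP _ finj].
have inc u : u \in [set u | adj G v u] -> incidence G v [set v; u].
  by rewrite inE => vu; apply/incidenceP; exists u.
pose g u := palette_code m (f v [set v; u]).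
have ginj : {in [set u | adj G v u] &, injective g}.
  move=> u w uP wP /palette_code_inj Efu.
  apply: (@set2_inj v); apply/eqP; apply: contraT => ne.
  by have := finj _ _ _ (inc _ uP) (inc _ wP) ne; rewrite Efu ?eqxx ?fP ?inc.
(* [inord] needs a nonempty ordinal type; for m = 0 the empty palette leaves [v] without
   neighbors. *)
case: m => [|m] in g fP ginj *.
  rewrite leqn0 cards_eq0; apply/eqP/setP=> u; rewrite [RHS]inE; apply/negP=> uP.
  by have := palette_code_lt (fP _ _ (inc _ uP)).
rewrite /degree -(card_in_imset (f := fun u => inord (g u) : 'I_m.+1)).
  by rewrite -[X in _ <= X]card_ord max_card.
move=> u w uP wP /(congr1 (@nat_of_ord _)).
by rewrite !inordK ?palette_code_lt ?fP ?inc //; apply: ginj.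
Qed.

Lemma edge_colorable_of_pairs (sigma : {set T} -> int) m (h : T -> T -> int) :
  (forall u v, adj G u v -> h u v \in palette m) ->
  (forall u v, adj G u v -> h u v = (- sigma [set u; v] * h v u)%R) ->
  (forall u v w, adj G u v -> adj G u w -> h u v = h u w -> v = w) ->
  edge_colorable G sigma m.
Proof.
move=> hP hsym hinj.
(* The pick recovers the other endpoint; on an incidence the default [v] never occurs. *)
pose f v (e : {set T}) := h v (odflt v [pick u in e | u != v]).
have fE u v : adj G u v -> f u [set u; v] = h u v.
  move=> uv; rewrite /f; case: pickP => /= [w|/(_ v)].
    by rewrite !inE => /andP[/orP[]/eqP->]; rewrite ?eqxx.
  by rewrite !inE eqxx orbT /= => /negbFE/eqP vu; rewrite vu adj_irr in uv.
exists f; split=> [v e /incidenceP[u vu ->]|u v uv|u e1 e2].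
- by rewrite fE ?hP.
- by rewrite fE // setUC fE 1?adj_sym // setUC hsym.
- case/incidenceP=> v uv -> /incidenceP[w uw ->]; rewrite !fE //.
  by apply: contra => /eqP /hinj ->.
Qed.

Lemma degree_lt_card v : degree G v < #|T|.
Proof.
rewrite -cardsT; apply: proper_card; rewrite properE subsetT /=.
by apply/subsetPn; exists v; rewrite !inE // adj_irr.
Qed.

End Graph.

(** * Degrees and colorings of the wheel *)

Lemma degree_hub n : degree (wheel n) None = n.-1.
Proof.
rewrite /degree (_ : [set u | _] = [set~ None]).
  by have := cardsC1 (None : option 'I_n.-1); rewrite card_option card_ord.
by apply/setP=> -[i|]; rewrite !inE.
Qed.

Lemma max_degree_wheel n : max_degree (wheel n) = n.-1.
Proof.
apply/eqP; rewrite eqn_leq; apply/andP; split; last first.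
  by rewrite -{1}(degree_hub n); apply: leq_bigmax.
apply/bigmax_leqP=> v _.
by rewrite -ltnS; apply: leq_trans (degree_lt_card _ v) _; rewrite card_option card_ord.
Qed.

Section WheelColoring.
Variables (n : nat) (hn : 4 <= n) (sigma : {set option 'I_n.-1} -> int).
Hypothesis sigmaP : signature (wheel n) sigma.

Let spoke_sign (i : 'I_n.-1) : int := sigma [set None; Some i].
(** The factor from the color at i to the color at i + 1 on a rim edge, once rim colors are rescaled
    by [- spoke_sign]. *)
Let rim_sign (i : 'I_n.-1) : int :=
  (- sigma [set Some i; Some (ordS i)] * spoke_sign i * spoke_sign (ordS i))%R.

Lemma ordS_neq (i : 'I_n.-1) : ordS i != i.
Proof. by apply/eqP=> /(congr1 val) /=; rewrite modnS_small //; case: ifP; lia. Qed.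

(** Separates the two rim neighbors of a vertex, so that [g] below can tell next from previous. *)
Lemma ordSS_neq (i : 'I_n.-1) : ordS (ordS i) != i.
Proof.
apply/eqP=> /(congr1 val) /=; rewrite (modnS_small (ltn_ord i)).
have lt_im := ltn_ord i.
by case: ifP => ?; rewrite modnS_small; try case: ifP; lia.
Qed.

Lemma wheel_sign (u v : option 'I_n.-1) : adj (wheel n) u v -> is_sign (sigma [set u; v]).
Proof. by move=> uv; apply: sigmaP; apply/imsetP; exists (u, v); rewrite ?inE. Qed.

Lemma spoke_signP i : is_sign (spoke_sign i).
Proof. exact: wheel_sign. Qed.

Lemma adj_ordS i : adj (wheel n) (Some i) (Some (ordS i)).
Proof. by rewrite /= eq_sym ordS_neq eqxx. Qed.

Lemma rim_signP i : is_sign (rim_sign i).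
Proof.
rewrite /rim_sign /is_sign.
by case: (wheel_sign (adj_ordS i)) (spoke_signP i) (spoke_signP (ordS i))
  => -> [->|->] [->|->]; rewrite ?mulrN1 ?mulr1 ?opprK; auto.
Qed.

Lemma edge_colorable_wheel : edge_colorable (wheel n) sigma n.-1.
Proof.
(* Outside the rim indices the value 1 keeps [s] a sign everywhere. *)
pose s k := oapp rim_sign 1%R (insub k).
have sE (i : 'I_n.-1) : s i = rim_sign i by rewrite /s valK.
have sP k : is_sign (s k).
  by rewrite /s; case: insub => [i|] /=; [exact: rim_signP | left].
have m3 : 3 <= n.-1 by lia.
have [a [b sch]] := rim_scheme_exists m3 sP.
pose g (i : 'I_n.-1) (u : option 'I_n.-1) : int :=
  if u is Some j then if j == ordS i then b i else (rim_sign j * b j)%R else a i.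
have g_next i : g i (Some (ordS i)) = b i by rewrite /g eqxx.
have g_prev i : g (ordS i) (Some i) = (rim_sign i * b i)%R.
  by rewrite /g eq_sym (negPf (ordSS_neq _)).
(* Undoes the switching of [g] at rim vertices. The 0 is only reached for the nonadjacent pair
   hub-hub. *)
pose h (u v : option 'I_n.-1) : int :=
  if u is Some i then (- spoke_sign i * g i v)%R else oapp (a \o val) 0%R v.
have adjP i j : adj (wheel n) (Some i) (Some j) -> j = ordS i \/ i = ordS j.
  by case/andP=> _ /orP[]/eqP; auto.
have pal (x c : int) : is_sign x -> c \in palette n.-1 -> (x * c)%R \in palette n.-1.
  by case=> ->; rewrite ?mul1r // mulN1r !inE /= abszN oppr_eq0.
have tt i : (spoke_sign i * spoke_sign i = 1)%R by case: (spoke_signP i) => ->.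
have next_neq_spoke (i : 'I_n.-1) : b i <> a i by apply: (rim_neq_spoke sch).
have prev_neq_spoke i : (rim_sign i * b i)%R <> a (ordS i).
  by rewrite -sE; apply: (rim_neq_next_spoke sch).
have prev_neq_next i : (rim_sign i * b i)%R <> b (ordS i).
  by rewrite -sE; apply: (rim_neq_next_rim sch).
have gP i u : adj (wheel n) (Some i) u -> g i u \in palette n.-1.
  case: u => [j /adjP[->|->]|_].
  - by rewrite g_next (rim_palette sch).
  - by rewrite g_prev pal ?(rim_palette sch) //; apply: rim_signP.
  - exact: (spoke_palette sch).
have ginj i u v : adj (wheel n) (Some i) u -> adj (wheel n) (Some i) v ->
    g i u = g i v -> u = v.
  case: u v => [j|] [k|] // =>
    [/adjP[->|Ej] /adjP[->|Ek]|/adjP[->|Ej] _|_ /adjP[->|Ek]] //.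
  - by rewrite g_next {1 2}Ek g_prev => /esym/prev_neq_next.
  - by rewrite g_next Ej g_prev => /prev_neq_next.
  - by rewrite (ordS_inj (etrans (esym Ej) Ek)).
  - by rewrite g_next => /next_neq_spoke.
  - by rewrite Ej g_prev => /prev_neq_spoke.
  - by rewrite g_next => /esym/next_neq_spoke.
  - by rewrite Ek g_prev => /esym/prev_neq_spoke.
have hsymS i : h (Some i) (Some (ordS i)) =
    (- sigma [set Some i; Some (ordS i)] * h (Some (ordS i)) (Some i))%R.
  rewrite /h g_next g_prev /rim_sign.
  by case: (wheel_sign (adj_ordS i)) (spoke_signP (ordS i)) => -> [->|->]; ring.
apply: (@edge_colorable_of_pairs _ _ _ _ h).
- case=> [i|] u.
    by move=> /gP; apply: pal; case: (spoke_signP i) => ->; [right | left].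
  by case: u => // i _; rewrite /h /= (spoke_palette sch).
- move=> [i|] [j|] //.
  + case/adjP=> [->|->]; first exact: hsymS.
    (* The reverse orientation follows since the edge sign squares to 1. *)
    rewrite hsymS setUC mulrA.
    by case: (wheel_sign (adj_ordS j)) => ->; ring.
  + by move=> _; rewrite setUC /h.
  + by move=> _; rewrite /h /= mulrA mulrNN tt mul1r.
- case=> [i|] u v iu iv; rewrite /h; last first.
    case: u v iu iv => [i|] // [j|] // _ _ /= E.
    by congr Some; apply: val_inj; apply: (spoke_inj sch) E.
  (* The switching factor is its own inverse, which reduces the claim to [g]. *)
  move/(congr1 (fun c => - spoke_sign i * c)%R).
  by rewrite !mulrA mulrNN tt !mul1r; apply: ginj.
Qed.

End WheelColoring.

Theorem theorem5 (n : nat) (hn : 4 <= n) : class1pm (wheel n).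
Proof.
move=> sigma sigmaP; rewrite /is_chromatic_index max_degree_wheel.
split; [lia | exact: edge_colorable_wheel | move=> m _ colm].
by rewrite -(degree_hub n); apply: degree_le_palette colm.
Qed.
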